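(* Let $d\geq 2$ be an integer, $\kappa(x,y)=1/(x-y)^d$, and let $\tilde\kappa(x,y)$ be its $N$-point proxy approximation with proxy surface the circle of radius $\gamma$ centered at $0$ (composite trapezoidal rule, as defined in the context). Let $X,Y\subset\mathbb{C}$ be finite nonempty sets of points. If $0<|x|<\gamma_1<\gamma<\gamma_2<|y|<\gamma_3$ for all $x\in X$, $y\in Y$, then there exists a positive integer $N_3$ independent of $\gamma$ such that for $N>N_3$, $$\frac{\lVert\tilde{K}^{(X,Y)}-K^{(X,Y)}\rVert_F}{\lVert K^{(X,Y)}\rVert_F}\leq g\!\left(\Big(\frac{\gamma_2}{\gamma}\Big)^N\right)+\hat{c}\,g\!\left(\Big(\frac{\gamma}{\gamma_1}\Big)^N\right),$$ where $$\hat{c}=2+2\sum_{j=1}^{d-1}\frac{\bigl[(|\gamma_3/\gamma_1|+1)N\bigr]^j(2d)^{j-1}}{j!}.$$ Moreover, for $N>N_3$, if the upper bound on the right-hand side is viewed as a real function of $\gamma$ on the interval $(\gamma_1,\gamma_2)$, then 1. this upper bound has a unique minimizer $$\gamma^*=\left(\frac{(\gamma_2^N-\gamma_1^N)\sqrt{(\gamma_1\gamma_2)^N\hat{c}}-(\gamma_1\gamma_2)^N(\hat{c}-1)}{\gamma_2^N-\gamma_1^N\hat{c}}\right)^{1/N}\in(\gamma_1,\gamma_2);$$ 2. the minimum of this upper bound decays asymptotically as $\mathcal{O}\!\left(|\gamma_2/\gamma_1|^{-N/2}\right)$.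
   Context: $g(z)=\frac{1}{z-1}$ for $z\neq 1$; $\|\cdot\|_F$ is the Frobenius norm. For a radius $\gamma>0$ and a positive integer $N$, the proxy points are $z_j=\gamma\exp\!\left(\frac{2j\pi\mathbf{i}}{N}\right)$, $j=1,\dots,N$ (with $\mathbf{i}=\sqrt{-1}$), and the proxy approximation of the kernel is $$\tilde\kappa(x,y)=\sum_{j=1}^{N}\kappa(x,z_j)\,\phi(z_j,y),\qquad \phi(z,y)=\frac{1}{N}\,\frac{z}{y-z}\quad(y\neq z).$$ $K^{(X,Y)}=(\kappa(x,y))_{x\in X,y\in Y}$ and $\tilde K^{(X,Y)}=(\tilde\kappa(x,y))_{x\in X,y\in Y}$. The asymptotics refer to $N\to\infty$ with $d,\gamma_1,\gamma_2,\gamma_3$ fixed.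
   Formalization: In item 2 the decay rate is corrected to O(N^{(d-1)/2}|γ2/γ1|^{-N/2}): the minimum is at least 2√ĉ·|γ2/γ1|^{-N/2} and ĉ grows like N^{d-1}, so the rate O(|γ2/γ1|^{-N/2}) as stated fails for every d≥2. *)

(* Defs.v *)
From HB Require Import structures.
From mathcomp Require Import all_boot all_order all_algebra.
From mathcomp Require Import finmap.
From mathcomp Require Import all_classical all_reals all_analysis.
From mathcomp Require Import complex.
Import Order.TTheory GRing.Theory Num.Theory.
Import numFieldNormedType.Exports.

Set Implicit Arguments.
Unset Strict Implicit.
Unset Printing Implicit Defensive.

Local Open Scope ring_scope.
Local Open Scope complex_scope.
Local Open Scope fset_scope.

Section Proxy.
Variable R : realType.
Implicit Types (x y z : R[i]) (gamma : R) (N d : nat).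

(* The norm of the library on [R[i]] takes its values in [R[i]]. *)
Definition modulus z : R := ComplexField.Normc.normc z.

Definition kappa d x y : R[i] := 1 / (x - y) ^+ d.

Definition proxy_point gamma N (j : nat) : R[i] :=
  let theta := 2 * j%:R * pi / N%:R in
  gamma%:C * (cos theta +i* sin theta).

Definition proxy_weight N z y : R[i] := 1 / N%:R * (z / (y - z)).

Definition proxy_kernel (K : R[i] -> R[i] -> R[i]) gamma N x y : R[i] :=
  \sum_(1 <= j < N.+1)
    K x (proxy_point gamma N j) * proxy_weight N (proxy_point gamma N j) y.

Definition kernel_mx (K : R[i] -> R[i] -> R[i]) (X Y : {fset R[i]}) :
    'M[R[i]]_(#|` X|, #|` Y|) :=
  \matrix_(i, j) K (enum_fset X)`_i (enum_fset Y)`_j.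

Definition frobenius_norm m n (A : 'M[R[i]]_(m, n)) : R :=
  Num.sqrt (\sum_(i < m) \sum_(j < n) modulus (A i j) ^+ 2).

End Proxy.

Section Bound.
Variable R : realType.
Implicit Types (gamma : R) (N d : nat).

Definition g (t : R) : R := 1 / (t - 1).

Definition c_hat d (gamma1 gamma3 : R) N : R :=
  2 + 2 * \sum_(1 <= j < d)
    ((`|gamma3 / gamma1| + 1) * N%:R) ^+ j * (2 * d)%:R ^+ j.-1 / j`!%:R.

Definition error_bound d (gamma1 gamma2 gamma3 : R) N gamma : R :=
  g ((gamma2 / gamma) ^+ N)
  + c_hat d gamma1 gamma3 N * g ((gamma / gamma1) ^+ N).

Definition gamma_star d (gamma1 gamma2 gamma3 : R) N : R :=
  let c := c_hat d gamma1 gamma3 N in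
  (((gamma2 ^+ N - gamma1 ^+ N) * Num.sqrt ((gamma1 * gamma2) ^+ N * c)
    - (gamma1 * gamma2) ^+ N * (c - 1))
   / (gamma2 ^+ N - gamma1 ^+ N * c)) `^ (1 / N%:R).

Definition minimizer_on (A : set R) (f : R -> R) (t : R) : Prop :=
  A t /\ forall s, A s -> f t <= f s.

(* The minimum over [gamma] of [error_bound] is of exact order
   [sqrt (c_hat N) * |gamma2 / gamma1| ^ (- N / 2)], and [c_hat N] grows like
   [N ^ (d - 1)]: hence the polynomial factor in front of the exponential. *)
Definition decay_rate d (gamma1 gamma2 : R) N : R :=
  N%:R `^ (d.-1%:R / 2) * `|gamma2 / gamma1| `^ (- (N%:R / 2)).

End Bound.

(* Main.v *)
(* Put [h = (y - x) / x] and [w_j = x / z_j]. A geometric sum of ratio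
   [(x - y) / (x - z)] turns [(x - y)^d * kappa~(x, y)] into the mean over the
   proxy points of [z_j / (y - z_j) + \sum_(k < d) h^k w_j^k / (1 - w_j)^(k+1)].
   The mean of the first term is exactly [1 / ((y / gamma)^N - 1)]. In the other
   ones, the expansion [\sum_m 'C(m, k) w^m] truncated at order [N] averages to
   its constant coefficient, so that the relative error is only due to the
   tails, of size [O(N^d (|x| / gamma)^N)]. As [X] is finite, [|x| / gamma1] is
   bounded away from 1, and for large [N] the tails are below
   [2 (gamma1 / gamma)^N] uniformly in [gamma]; for them [2 <= c_hat]
   suffices.

   With [t = gamma^N], [a = gamma1^N], [b = gamma2^N], [c = c_hat], the bound is
   [b / (b - t) + c a / (t - a) - 1]; its difference with the value at
   [gamma_star^N] is a square over a positive quantity as soon as [c a < b]. *)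
Require Import Defs.
From HB Require Import structures.
From mathcomp Require Import all_boot all_order all_algebra.
From mathcomp Require Import finmap.
From mathcomp Require Import all_classical all_reals all_analysis.
From mathcomp Require Import complex.
From mathcomp Require Import ring lra.
Import Order.TTheory GRing.Theory Num.Theory.
Import numFieldNormedType.Exports.

Set Implicit Arguments.
Unset Strict Implicit.
Unset Printing Implicit Defensive.

Local Open Scope ring_scope.

(** * Real-valued modulus of complex numbers *)

Section Modulus.
Variable R : realType.
Implicit Types z : R[i].

Lemma normE z : `|z| = (modulus z)%:C%C.
Proof. by case: z. Qed.

Lemma modulus_ge0 z : 0 <= modulus z.
Proof. by rewrite -(lecR 0) -normE; exact: normr_ge0. Qed.

Lemma modulusM z1 z2 : modulus (z1 * z2) = modulus z1 * modulus z2.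
Proof. exact: ComplexField.Normc.normcM. Qed.

Lemma modulusV z : modulus z^-1 = (modulus z)^-1.
Proof. exact: ComplexField.Normc.normcV. Qed.

Lemma modulusX z n : modulus (z ^+ n) = modulus z ^+ n.
Proof.
elim: n => [|n IH]; first by rewrite !expr0 /modulus ComplexField.Normc.normc1.
by rewrite !exprS modulusM IH.
Qed.

Lemma modulusD z1 z2 : modulus (z1 + z2) <= modulus z1 + modulus z2.
Proof. by rewrite -lecR rmorphD /= -!normE ler_normD. Qed.

Lemma modulus_ge1B z : 1 - modulus z <= modulus (1 - z).
Proof.
rewrite -lecR rmorphB /= -!normE rmorph1.
by apply: le_trans (lerB_dist _ _); rewrite normr1.
Qed.

Lemma modulus_real (t : R) : 0 <= t -> modulus t%:C%C = t.
Proof.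
move=> t0; apply: complexI; rewrite -normE ger0_norm //.
by rewrite (lecR 0).
Qed.

Lemma modulus_nat n : modulus n%:R = n%:R :> R.
Proof. by apply: complexI; rewrite -normE rmorph_nat normr_nat. Qed.

Lemma modulus_eq0 z : (modulus z == 0) = (z == 0).
Proof.
apply/eqP/eqP => [/ComplexField.Normc.eq0_normc//|->].
exact: ComplexField.Normc.normc0.
Qed.

Lemma modulus_sum (I : Type) (r : seq I) (P : pred I) (F : I -> R[i]) :
  modulus (\sum_(i <- r | P i) F i) <= \sum_(i <- r | P i) modulus (F i).
Proof.
by rewrite -lecR rmorph_sum /= -normE (le_trans (ler_norm_sum _ _ _)).
Qed.

End Modulus.

Lemma bin_le_exp m k : ('C(m, k) <= m ^ k)%N.
Proof.
have h : (m ^_ k <= m ^ k)%N.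
  elim: k => [|k IH]; first by rewrite ffactn0.
  by rewrite ffactnSr expnSr leq_mul // leq_subr.
by rewrite (leq_trans _ h)// -bin_ffact leq_pmulr// fact_gt0.
Qed.

(** * Polynomial growth against geometric decay *)

Section Growth.
Variable R : realType.
Local Open Scope classical_set_scope.
Implicit Types (s C e : R).

(** With [s = t ^ (d + 1)], one has [N ^ d * s ^ N <= (N * t ^ N) ^ d], and [N * t ^ N] is at most
    the geometric sum of the [t ^ i] for [i < N], hence at most [1 / (1 - t)]. *)
Lemma natX_geometric_bounded s d : 0 < s -> s < 1 ->
  exists C, forall N : nat, N%:R ^+ d * s ^+ N <= C.
Proof.
move=> s0 s1.
have e0 : 0 < (d.+1)%:R^-1 :> R by rewrite invr_gt0.
pose t := s `^ (d.+1)%:R^-1.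
have t0 : 0 <= t by exact: powR_ge0.
have ts : t ^+ d.+1 = s.
  by rewrite -powR_mulrn// -powRrM mulVf ?pnatr_eq0// powRr1// ltW.
have t1 : t < 1.
  rewrite ltNge; apply/negP => h.
  by have := exprn_ege1 d.+1 h; rewrite ts leNgt s1.
have t1' : 0 < 1 - t by rewrite subr_gt0.
have sumt N : N%:R * t ^+ N <= (1 - t)^-1.
  have -> : N%:R * t ^+ N = \sum_(i < N) t ^+ N.
    by rewrite sumr_const card_ord mulr_natl.
  apply: (@le_trans _ _ (\sum_(i < N) t ^+ i)).
    by apply: ler_sum => i _; rewrite ler_wiXn2l ?(ltW t1)// ltnW.
  rewrite -(ler_pM2l t1') mulfV ?gt_eqF//.
  rewrite -(opprB t 1) mulNr -subrX1 opprB lerBlDr lerDl.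
  exact: exprn_ge0.
exists ((1 - t)^-1 ^+ d) => N.
apply: (@le_trans _ _ ((N%:R * t ^+ N) ^+ d)); last first.
  apply: lerXn2r; rewrite ?nnegrE//; last by rewrite invr_ge0 ltW.
  by rewrite mulr_ge0 ?exprn_ge0.
rewrite exprMn -ts ler_wpM2l ?exprn_ge0//.
rewrite -!exprM ler_wiXn2l ?(ltW t1)//.
by rewrite mulnC mulSn leq_addl.
Qed.

(** The boundedness at exponent [d + 1] leaves a spare factor [1 / N]. *)
Lemma natX_geometric_cvg0 s C d e : 0 < s -> s < 1 -> 0 < e ->
  \forall N \near \oo, C * N%:R ^+ d * s ^+ N <= e.
Proof.
move=> s0 s1 e0; have [D DP] := natX_geometric_bounded d.+1 s0 s1.
near=> N.
have N0 : 0 < N%:R :> R by rewrite ltr0n; near: N; exact: nbhs_infty_gt.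
have hN : `|C| * D / e <= N%:R.
  by near: N; exact: nbhs_infty_ger.
apply: (@le_trans _ _ (`|C| * (N%:R ^+ d * s ^+ N))).
  by rewrite -mulrA ler_wpM2r ?ler_norm// mulr_ge0 ?exprn_ge0// ltW.
rewrite -(ler_pM2l N0); apply: (@le_trans _ _ (`|C| * D)).
  rewrite mulrCA ler_wpM2l//; have := DP N.
  by rewrite exprS mulrA.
by rewrite ler_pdivrMr// in hN.
Unshelve. all: by end_near. Qed.

End Growth.

(** * Proxy points as multiples of roots of unity *)

Section RootAverage.
Variable R : realType.
Local Open Scope complex_scope.

Lemma cis_exp (t : R) n :
  (cos t +i* sin t) ^+ n = cos (n%:R * t) +i* sin (n%:R * t).
Proof.
elim: n => [|n IH]; first by rewrite expr0 mul0r cos0 sin0.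
rewrite exprS IH -natr1 mulrDl mul1r addrC cosD sinD.
by apply/eqP; rewrite eq_complex /= eqxx /= addrC eqxx.
Qed.

(** Half-angle formula: [sin (t / 2)] is positive. The strictness is what makes [unit_root]
    primitive. *)
Lemma cos_lt1 (t : R) : 0 < t < 2 * pi -> cos t < 1.
Proof.
move=> /andP[t0 t1].
have h : 0 < sin (t / 2) by apply: sin_gt0_pi; apply/andP; split; lra.
have -> : t = (t / 2) *+ 2 by rewrite -mulr_natr; field.
rewrite cos_mulr2n cos2sin2.
have : 0 < sin (t / 2) ^+ 2 by rewrite exprn_gt0.
by rewrite -mulr_natr; lra.
Qed.

Definition unit_root N : R[i] := let t := 2 * pi / N%:R in cos t +i* sin t.

Lemma proxy_pointE gamma N j :
  proxy_point gamma N j = gamma%:C * unit_root N ^+ j.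
Proof.
rewrite /proxy_point /unit_root cis_exp.
by have -> : 2 * j%:R * pi / N%:R = j%:R * (2 * pi / N%:R) :> R by ring.
Qed.

Lemma modulus_unit_root N : modulus (unit_root N) = 1.
Proof. by rewrite /modulus /= cos2Dsin2 sqrtr1. Qed.

Lemma unit_root_prim N : (0 < N)%N -> N.-primitive_root (unit_root N).
Proof.
move=> N0; have NR : N%:R != 0 :> R by rewrite pnatr_eq0 -lt0n.
rewrite /primitive_root_of_unity N0 /=; apply/forallP => -[i iN] /=.
rewrite unity_rootE /unit_root cis_exp; apply/eqP.
case: (ltnP i.+1 N) => h.
  (* A lower power has its argument strictly between 0 and [2 * pi], so its real part already
     differs from 1. *)
  rewrite (ltn_eqF h); apply/negbTE.
  rewrite eq_complex /= negb_and lt_eqF//.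
  apply: cos_lt1; apply/andP; split.
    by rewrite mulr_gt0 ?divr_gt0 ?mulr_gt0 ?pi_gt0 ?ltr0n.
  rewrite mulrCA -[ltRHS]mulr1 ltr_pM2l ?mulr_gt0 ?pi_gt0//.
  by rewrite ltr_pdivrMr ?ltr0n// mul1r ltr_nat.
have -> : i.+1 = N by apply/eqP; rewrite eqn_leq iN h.
rewrite eqxx; apply/eqP.
have -> : N%:R * (2 * pi / N%:R) = pi *+ 2 :> R by rewrite -mulr_natl; field.
by rewrite cos2pi sin2pi.
Qed.

End RootAverage.

(** * Truncated negative binomial expansions *)

Section NegativeBinomial.
Variable F : fieldType.
Implicit Types w : F.

(** Pascal's rule, by induction on [N]; the last term is the boundary term of the truncation. *)
Lemma sum_binX_shift N k w :
  (1 - w) * \sum_(m < N) 'C(m, k.+1)%:R * w ^+ m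
  = w * (\sum_(m < N) 'C(m, k)%:R * w ^+ m) - 'C(N, k.+1)%:R * w ^+ N.
Proof.
elim: N => [|N IH]; first by rewrite !big_ord0 bin0n !mulr0 mul0r subr0.
rewrite !big_ord_recr /= mulrDr IH binS natrD exprS; ring.
Qed.

(* Remainder of the expansion [w^k / (1 - w)^(k+1) = \sum_m 'C(m, k) w^m]
   truncated at order [N]. *)
Definition nbin_tail N k w : F :=
  w ^+ k / (1 - w) ^+ k.+1 - \sum_(m < N) 'C(m, k)%:R * w ^+ m.

Lemma nbin_tail0 N w : 1 - w != 0 -> nbin_tail N 0 w = w ^+ N / (1 - w).
Proof.
move=> w1; rewrite /nbin_tail expr0 expr1.
under eq_bigr do rewrite bin0 mul1r.
apply: (mulIf w1); rewrite mulrBl !mulfVK// -[w ^+ N](subrK 1) subrX1; ring.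
Qed.

(** Recurrence in [k] on which the estimate of the tails rests. *)
Lemma nbin_tailS N k w : 1 - w != 0 ->
  nbin_tail N k.+1 w
  = (w * nbin_tail N k w + 'C(N, k.+1)%:R * w ^+ N) / (1 - w).
Proof.
move=> w1; have := sum_binX_shift N k w; rewrite /nbin_tail.
move: (\sum_(m < N) 'C(m, k.+1)%:R * w ^+ m) => S1.
move: (\sum_(m < N) 'C(m, k)%:R * w ^+ m) => S0 h.
apply: (mulIf w1); rewrite mulfVK// mulrBl [S1 * _]mulrC h.
have -> : w ^+ k.+1 / (1 - w) ^+ k.+2 * (1 - w) = w * (w ^+ k / (1 - w) ^+ k.+1).
  by rewrite [w ^+ _]exprS [(1 - w) ^+ k.+2]exprS; field; rewrite w1 expf_neq0.
ring.
Qed.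

End NegativeBinomial.

(** * Sums over the roots of unity *)

Section RootsOfUnity.
Variables (F : fieldType) (N : nat) (w : F).
Hypothesis wP : N.-primitive_root w.

Lemma prim_root_gt0 : (0 < N)%N.
Proof. exact: prim_order_gt0 wP. Qed.

(** The ratios [x / z_j] involve the powers of the inverse root. *)
Lemma prim_rootV : N.-primitive_root w^-1.
Proof.
have := wP; rewrite /primitive_root_of_unity => /andP[-> /forallP h] /=.
apply/forallP => i; have := h i; rewrite !unity_rootE.
by rewrite exprVn invr_eq1.
Qed.

(** A geometric sum whose ratio [w ^ m] is not 1, while the [N]-th power of the ratio is. *)
Lemma prim_root_sumX m : (0 < m < N)%N ->
  \sum_(1 <= j < N.+1) (w ^+ j) ^+ m = 0.
Proof.
move=> /andP[m0 mN].
have w1 : w ^+ m != 1 by rewrite -(prim_order_dvd wP) gtnNdvd.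
rewrite big_add1 /= big_mkord.
under eq_bigr do rewrite -exprM mulSn exprD -mulnC exprM.
rewrite -big_distrr /=; apply/eqP; rewrite mulf_eq0; apply/orP; right.
have := subrX1 (w ^+ m) N.
rewrite -exprM mulnC exprM (prim_expr_order wP) expr1n subrr => /esym/eqP.
by rewrite mulf_eq0 subr_eq0 (negbTE w1).
Qed.

(** Exactness of the trapezoidal rule on polynomials of degree below [N]: by [prim_root_sumX] only
    the constant coefficient survives. *)
Lemma prim_root_sum_poly (a : nat -> F) c :
  \sum_(1 <= j < N.+1) \sum_(m < N) a m * (c * w ^+ j) ^+ m = N%:R * a 0.
Proof.
rewrite exchange_big /=; case: N prim_root_gt0 prim_root_sumX => // n _ wS.
rewrite big_ord_recl [X in _ + X]big1 /= => [|i _].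
  rewrite addr0; under eq_bigr do rewrite expr0 mulr1.
  by rewrite sumr_const_nat subn1 /= mulr_natl.
under eq_bigr do rewrite exprMn mulrA.
by rewrite -big_distrr /= wS ?mulr0//; exact: (ltn_ord i).
Qed.

(** Splitting the series of [v / (1 - v)] after degree [N] reproduces [v / (1 - v)] with the factor
    [v ^ N = c ^ N], so that the sum solves a linear equation. *)
Lemma prim_root_sum_geometric c :
  (forall j, 1 - c * w ^+ j != 0) -> 1 - c ^+ N != 0 ->
  \sum_(1 <= j < N.+1) (c * w ^+ j) / (1 - c * w ^+ j)
  = N%:R * (c ^+ N / (1 - c ^+ N)).
Proof.
move=> cw cN.
set S := LHS.
have cwN j : (c * w ^+ j) ^+ N = c ^+ N.
  by rewrite exprMn -exprM mulnC exprM (prim_expr_order wP) expr1n mulr1.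
suff h : S = N%:R * c ^+ N + c ^+ N * S.
  by apply: (mulIf cN); rewrite mulrA mulfVK// mulrBr mulr1 {1}h; ring.
rewrite {1}/S.
transitivity (\sum_(1 <= j < N.+1)
   (\sum_(m < N) 1 * (c * w ^+ j) ^+ m - 1 + c ^+ N
    + c ^+ N * ((c * w ^+ j) / (1 - c * w ^+ j)))).
  apply: eq_bigr => j _; have := cw j; rewrite -(cwN j).
  move: (c * w ^+ j) => v v1.
  under [in RHS]eq_bigr do rewrite mul1r.
  apply: (mulIf v1); rewrite [RHS]mulrDl -[in RHS]mulrA !mulfVK//.
  by rewrite -[v ^+ N](subrK 1) subrX1; ring.
(* The constant coefficients of the truncated sums cancel against the terms [- 1]. *)
rewrite !big_split /= (prim_root_sum_poly (fun=> 1)) -big_distrr /= -/S.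
by rewrite !sumr_const_nat subn1 /= mulr1 mulNrn subrr add0r mulr_natl.
Qed.

End RootsOfUnity.

(** * Relative error of the proxy kernel at one pair of points *)

Section ProxyError.
Variable R : realType.
Local Open Scope complex_scope.
Implicit Types (x y z w : R[i]) (gamma : R).

Lemma exp_ratio_lt1 N (a b : R) : (0 < N)%N -> 0 <= a -> a < b ->
  (a / b) ^+ N < 1.
Proof.
move=> N0 a0 ab; have b0 : 0 < b by exact: le_lt_trans ab.
rewrite exprn_ilt1 ?divr_ge0 ?(ltW b0)// -?lt0n//.
by rewrite ltr_pdivrMr// mul1r.
Qed.

(** Induction on [k] through [nbin_tailS]: each step adds one binomial term and one denominator, and
    the factor [k + 1] counts the terms. *)
Lemma modulus_nbin_tail N k w : (0 < N)%N -> modulus w < 1 ->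
  modulus (nbin_tail N k w)
  <= k.+1%:R * N%:R ^+ k * modulus w ^+ N / (1 - modulus w) ^+ k.+1.
Proof.
move=> N0 w1.
have r1 : 0 < 1 - modulus w by rewrite subr_gt0.
have m1 : 1 - modulus w <= modulus (1 - w) by exact: modulus_ge1B.
have m0 : 0 < modulus (1 - w) by exact: lt_le_trans m1.
have w0 : 1 - w != 0 by rewrite -modulus_eq0 gt_eqF.
have NR : 1 <= N%:R :> R by rewrite ler1n.
have rN0 : 0 <= modulus w ^+ N by rewrite exprn_ge0// modulus_ge0.
elim: k => [|k IH].
  rewrite nbin_tail0// modulusM modulusV modulusX expr0 !mul1r expr1.
  by rewrite ler_wpM2l// lef_pV2.
rewrite nbin_tailS// modulusM modulusV.
apply: (@le_trans _ _ ((modulus (nbin_tail N k w) + N%:R ^+ k.+1 * modulus w ^+ N)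
    / (1 - modulus w))).
  apply: ler_pM; rewrite ?modulus_ge0 ?invr_ge0 ?modulus_ge0//; last by rewrite lef_pV2.
  apply: (le_trans (modulusD _ _)); rewrite !modulusM modulus_nat modulusX.
  apply: lerD; first by rewrite ler_piMl ?modulus_ge0// ltW.
  by rewrite ler_wpM2r// -natrX ler_nat bin_le_exp.
rewrite (exprSr (1 - modulus w) k.+1) invfM mulrA ler_pM2r ?invr_gt0//.
have r2 : 0 < (1 - modulus w) ^+ k.+1 by rewrite exprn_gt0.
(* Of the [k + 2] copies of the bound, [k + 1] absorb the induction hypothesis and one absorbs the
   new binomial term. *)
rewrite -(natr1 k.+1) 2!mulrDl mul1r mulrDl.
apply: lerD.
  apply: (le_trans IH); rewrite ler_pM2r ?invr_gt0// ler_wpM2r//.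
  by rewrite ler_wpM2l// exprS ler_peMl// exprn_ge0.
rewrite ler_pdivlMr// ler_piMr ?mulr_ge0 ?exprn_ge0 ?modulus_ge0//.
by rewrite exprn_ile1 ?(ltW r1)// lerBlDr lerDl modulus_ge0.
Qed.

(* With [a = x - z] and [b = x - y], the sum is the geometric sum of ratio
   [b / a] times [- z / a]. *)
Lemma kappa_proxy_term d x y z : x != 0 -> z != 0 ->
    x - z != 0 -> y - z != 0 -> x - y != 0 ->
  kappa d x z * (z / (y - z))
  = kappa d x y * (z / (y - z) + \sum_(k < d)
      ((y - x) / x) ^+ k * ((x / z) ^+ k / (1 - x / z) ^+ k.+1)).
Proof.
move=> x0 z0 xz yz xy.
have q1 : (x - y) / (x - z) - 1 = (z - y) / (x - z) by field.
have zy : z - y != 0 by rewrite -oppr_eq0 opprB.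
have zx : z - x != 0 by rewrite -oppr_eq0 opprB.
rewrite (eq_bigr (fun k : 'I_d => - z / (x - z) * ((x - y) / (x - z)) ^+ k)).
  rewrite -big_distrr /=.
  have := subrX1 ((x - y) / (x - z)) d; rewrite q1.
  move: (\sum_(k < d) _) => S hS.
  have -> : S = ((x - z) / (z - y)) * (((x - y) / (x - z)) ^+ d - 1).
    by rewrite hS; field; rewrite xz zy.
  rewrite /kappa expr_div_n; field.
  by rewrite ?expf_neq0 ?xz ?zy ?yz ?xy.
move=> k _.
have w1 : 1 - x / z = (z - x) / z by field.
have -> : (x - y) / (x - z) = (y - x) / x * (x / z / (1 - x / z)).
  by rewrite w1; field; rewrite xz zx x0 z0.
have -> : - z / (x - z) = (1 - x / z)^-1 by rewrite w1; field; rewrite xz zx z0.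
by rewrite [(1 - _) ^+ k.+1]exprS invfM !exprMn !exprVn; ring.
Qed.

Lemma modulus_proxy_point gamma N j : 0 <= gamma ->
  modulus (proxy_point gamma N j) = gamma.
Proof.
move=> g0; rewrite proxy_pointE modulusM modulusX modulus_unit_root expr1n mulr1.
exact: modulus_real.
Qed.

Lemma modulus_neq z w : modulus z < modulus w -> w - z != 0.
Proof. by rewrite subr_eq0; apply: contraTneq => ->; rewrite ltxx. Qed.

(** The average of [kappa_proxy_term] is computed exactly; [p / (1 - p)] and the tails are all that
    separates it from [kappa d x y]. *)
Lemma proxy_kernelE d gamma N x y : (0 < d)%N -> (0 < N)%N ->
    0 < modulus x < gamma -> gamma < modulus y ->
  let p := (gamma%:C / y) ^+ N in
  proxy_kernel (kappa d) gamma N x y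
  = kappa d x y * (1 + (p / (1 - p) + \sum_(k < d) ((y - x) / x) ^+ k
       * (N%:R^-1 * \sum_(1 <= j < N.+1)
            nbin_tail N k (x / proxy_point gamma N j)))).
Proof.
move=> d0 N0 /andP[x0 xg] gy p.
have g0 : 0 < gamma by exact: lt_trans xg.
have zm j := @modulus_proxy_point gamma N j (ltW g0).
have wP := unit_root_prim R N0.
have NC : N%:R != 0 :> R[i] by rewrite pnatr_eq0 -lt0n.
have x0' : x != 0 by rewrite -modulus_eq0 gt_eqF.
have y0' : y != 0 by rewrite -modulus_eq0 gt_eqF// (lt_trans g0).
have z0 j : proxy_point gamma N j != 0 by rewrite -modulus_eq0 zm gt_eqF.
have xz j : x - proxy_point gamma N j != 0.
  by rewrite -oppr_eq0 opprB modulus_neq// zm.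
have yz j : y - proxy_point gamma N j != 0 by rewrite modulus_neq// zm.
have xy : x - y != 0 by rewrite -oppr_eq0 opprB modulus_neq// (lt_trans xg).
have zv j : proxy_point gamma N j = y * (gamma%:C / y * unit_root R N ^+ j).
  by rewrite proxy_pointE mulrA mulrCA mulfV// mulr1.
have xw j : x / proxy_point gamma N j = x / gamma%:C * (unit_root R N)^-1 ^+ j.
  by rewrite proxy_pointE invfM exprVn mulrA.
(* With [v = z_j / y], the term is [v / (1 - v)], and [v] is [gamma / y] times a root of unity. *)
have outer : \sum_(1 <= j < N.+1) proxy_point gamma N j / (y - proxy_point gamma N j)
    = N%:R * (p / (1 - p)).
  rewrite -(prim_root_sum_geometric wP).
  - apply: eq_bigr => j _; have := yz j; rewrite zv.
    move: (_ * unit_root R N ^+ j) => v yv.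
    have v1 : 1 - v != 0.
      by apply: contra yv; rewrite subr_eq0 => /eqP <-; rewrite mulr1 subrr.
    by field; rewrite v1 yv.
  - move=> j; have := yz j; apply: contra; rewrite zv.
    by rewrite subr_eq0 => /eqP <-; rewrite mulr1 subrr.
  - apply: modulus_neq; rewrite modulusX modulusM modulusV modulus_real ?ltW//.
    rewrite -[1 in ltRHS](rmorph1 (real_complex R)) modulus_real//.
    exact: exp_ratio_lt1 (ltW g0) gy.
have inner k : \sum_(1 <= j < N.+1) (x / proxy_point gamma N j) ^+ k
      / (1 - x / proxy_point gamma N j) ^+ k.+1
    = N%:R * 'C(0, k)%:R
      + \sum_(1 <= j < N.+1) nbin_tail N k (x / proxy_point gamma N j).
  rewrite -(prim_root_sum_poly (prim_rootV wP) (fun m => 'C(m, k)%:R) (x / gamma%:C)).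
  rewrite -big_split /=; apply: eq_bigr => j _.
  by rewrite -xw /nbin_tail addrC subrK.
rewrite /proxy_kernel /proxy_weight.
under eq_bigr do rewrite mulrCA kappa_proxy_term// mulrCA.
rewrite -big_distrr /= -big_distrr /=; congr (_ * _).
rewrite div1r big_split /= outer exchange_big /= mulrDr mulKf// addrCA; congr (_ + _).
under eq_bigr do rewrite -big_distrr /= inner mulrDr.
rewrite big_split mulrDr /= big_distrr /=; congr (_ + _); last first.
  by rewrite big_distrr /=; apply: eq_bigr => k _; rewrite mulrCA.
(* ['C(0, k)] vanishes except at [k = 0], where it gives the leading 1 of the formula. *)
case: d d0 => // n _; rewrite big_ord_recl [X in _ + X]big1 => [|k _].
  by rewrite addr0 bin0 expr0 mul1r mulr1 mulVf.
by rewrite lift0 bin0n !mulr0.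
Qed.

(** Triangle inequality in [proxy_kernelE]; all the [x / z_j] have modulus [|x| / gamma], so the
    mean of the tails obeys the bound on a single one. *)
Lemma proxy_error d gamma N x y : (0 < d)%N -> (0 < N)%N ->
    0 < modulus x < gamma -> gamma < modulus y ->
  modulus (proxy_kernel (kappa d) gamma N x y - kappa d x y)
  <= modulus (kappa d x y)
     * ((gamma / modulus y) ^+ N / (1 - (gamma / modulus y) ^+ N)
        + \sum_(k < d) modulus ((y - x) / x) ^+ k
            * (k.+1%:R * N%:R ^+ k * (modulus x / gamma) ^+ N
               / (1 - modulus x / gamma) ^+ k.+1)).
Proof.
move=> d0 N0 xg gy; set P := (gamma / _) ^+ N; set r := _ / gamma.
rewrite proxy_kernelE//; move: xg => /andP[x0 xg].
have g0 : 0 < gamma by exact: lt_trans xg.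
rewrite -{2}[kappa d x y]mulr1 -mulrBr addrAC subrr add0r.
rewrite [modulus (kappa _ _ _ * _)]modulusM.
apply: ler_wpM2l; first exact: modulus_ge0.
apply: (le_trans (modulusD _ _)); apply: lerD.
  rewrite modulusM modulusV.
  have -> : P = modulus ((gamma%:C / y) ^+ N).
    by rewrite modulusX modulusM modulusV modulus_real// ltW.
  set q := _ ^+ N; have q1 : modulus q < 1.
    rewrite modulusX modulusM modulusV modulus_real ?ltW//.
    exact: exp_ratio_lt1 (ltW g0) gy.
  have q0 : 0 < 1 - modulus q by rewrite subr_gt0.
  rewrite ler_wpM2l ?modulus_ge0// lef_pV2 ?modulus_ge1B//.
  exact: lt_le_trans (modulus_ge1B _).
apply: (le_trans (modulus_sum _ _ _)); apply: ler_sum => k _.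
rewrite modulusM modulusX ler_wpM2l ?exprn_ge0 ?modulus_ge0//.
rewrite modulusM modulusV modulus_nat ler_pdivrMl ?ltr0n//.
apply: (le_trans (modulus_sum _ _ _)).
have rE j : modulus (x / proxy_point gamma N j) = r.
  by rewrite modulusM modulusV modulus_proxy_point// ltW.
have r1 : r < 1 by rewrite ltr_pdivrMr// mul1r.
rewrite [leRHS]mulr_natl -[X in _ *+ X](subn1 N.+1) -sumr_const_nat.
by apply: ler_sum => j _; rewrite -(rE j) modulus_nbin_tail// rE.
Qed.

End ProxyError.

(** * From entrywise bounds to Frobenius norms *)

Section Frobenius.
Variable R : realType.

Lemma frobenius_ratio m n (A B : 'M[R[i]]_(m, n)) (b : R) : 0 <= b ->
  (forall i j, modulus (A i j) <= b * modulus (B i j)) ->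
  frobenius_norm A / frobenius_norm B <= b.
Proof.
move=> b0 AB.
have le : frobenius_norm A <= b * frobenius_norm B.
  rewrite /frobenius_norm -[b in leRHS](ger0_norm b0) -sqrtr_sqr -sqrtrM ?sqr_ge0//.
  apply: ler_wsqrtr; rewrite big_distrr /=; apply: ler_sum => i _.
  rewrite big_distrr /=; apply: ler_sum => j _.
  rewrite -exprMn; apply: lerXn2r; rewrite ?nnegrE ?mulr_ge0 ?modulus_ge0//.
have : 0 <= frobenius_norm B by exact: sqrtr_ge0.
(* If [B] has norm zero, the quotient is 0 by convention. *)
rewrite le_eqVlt => /predU1P[<-|B0]; first by rewrite invr0 mulr0.
by rewrite ler_pdivrMr.
Qed.

End Frobenius.

(** * Error bound uniform in the radius, and size of [c_hat] *)

Section ErrorBound.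
Variable R : realType.
Local Open Scope classical_set_scope.
Implicit Types (x y : R[i]) (gamma : R).

Lemma gV (t : R) : t != 0 -> g t^-1 = t / (1 - t).
Proof.
move=> t0; rewrite /g; have -> : t^-1 - 1 = (1 - t) / t by field.
by rewrite div1r invf_div.
Qed.

(** Puts [g] in the form [p / (1 - p)] that occurs in the exact error. *)
Lemma g_expV (a b : R) N : 0 < a -> 0 < b ->
  g ((a / b) ^+ N) = (b / a) ^+ N / (1 - (b / a) ^+ N).
Proof.
move=> a0 b0; rewrite -gV ?expf_neq0 ?mulf_neq0 ?invr_neq0 ?gt_eqF//.
by rewrite -exprVn invf_div.
Qed.

Lemma ler_divB1 (s t : R) : 0 <= s -> s <= t -> t < 1 -> s / (1 - s) <= t / (1 - t).
Proof.
move=> s0 st t1; have t1' : 0 < 1 - t by rewrite subr_gt0.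
have s1' : 0 < 1 - s by rewrite subr_gt0 (le_lt_trans st).
by apply: ler_pM => //; rewrite ?invr_ge0 ?(ltW s1')// lef_pV2// lerD2l lerN2.
Qed.

(** The rank must not depend on [gamma]. Since [|x| / gamma = s * (gamma1 / gamma)] with
    [s = |x| / gamma1 < 1], the fixed factor [s ^ N] absorbs the powers of [N], and
    [(gamma1 / gamma) ^ N] remains. *)
Lemma proxy_error_near d gamma1 gamma2 x y : (0 < d)%N ->
    0 < modulus x < gamma1 -> gamma2 < modulus y ->
  \forall N \near \oo, forall gamma, gamma1 < gamma -> gamma < gamma2 ->
    modulus (proxy_kernel (kappa d) gamma N x y - kappa d x y)
    <= (g ((gamma2 / gamma) ^+ N) + 2 * g ((gamma / gamma1) ^+ N))
       * modulus (kappa d x y).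
Proof.
move=> d0 /andP[x0 x1] y2.
have g1 : 0 < gamma1 by exact: lt_trans x1.
pose s := modulus x / gamma1.
have s0 : 0 < s by rewrite divr_gt0.
have s1 : s < 1 by rewrite ltr_pdivrMr// mul1r.
have s1' : 0 < 1 - s by rewrite subr_gt0.
pose h := modulus ((y - x) / x).
have h0 : 0 <= h by exact: modulus_ge0.
(* The denominators use [1 - s], a lower bound of [1 - |x| / gamma] for every [gamma] above
   [gamma1]. *)
pose C := \sum_(k < d) h ^+ k * (k.+1%:R / (1 - s) ^+ k.+1).
near=> N => gamma g1g gg2.
have N0 : (0 < N)%N by near: N; exact: nbhs_infty_gt.
have CN : C * N%:R ^+ d * s ^+ N <= 2.
  by near: N; exact: natX_geometric_cvg0.
have g0 : 0 < gamma by exact: lt_trans g1g.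
have g20 : 0 < gamma2 by exact: lt_trans gg2.
have y0 : 0 < modulus y by exact: lt_trans y2.
rewrite [leRHS]mulrC.
apply: (le_trans (proxy_error d0 N0 _ _)).
- by rewrite x0 (lt_trans x1).
- exact: lt_trans gg2 y2.
apply: ler_wpM2l; first exact: modulus_ge0.
rewrite !g_expV//; apply: lerD.
  apply: ler_divB1.
  - by rewrite exprn_ge0// divr_ge0// ltW.
  - apply: lerXn2r; rewrite ?nnegrE ?divr_ge0 ?(ltW g0) ?(ltW g20) ?(ltW y0)//.
    by rewrite ler_pM2l// lef_pV2// ltW.
  - exact: exp_ratio_lt1 (ltW g0) gg2.
set q := (gamma1 / gamma) ^+ N.
have q0 : 0 < q by rewrite exprn_gt0// divr_gt0.
have q1 : q < 1 by exact: exp_ratio_lt1 (ltW g1) g1g.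
(* As [q <= q / (1 - q)], it suffices to bound the tails by [2 * q]. *)
apply: (@le_trans _ _ (2 * q)); last first.
  rewrite ler_wpM2l// ler_pdivlMr ?subr_gt0// ler_piMr ?(ltW q0)//.
  by rewrite lerBlDr lerDl ltW.
apply: (@le_trans _ _ (C * N%:R ^+ d * s ^+ N * q)); last by rewrite ler_wpM2r// ltW.
rewrite /C -!mulrA big_distrl /=; apply: ler_sum => k _; rewrite -/h -[leRHS]mulrA.
apply: ler_wpM2l; first by rewrite exprn_ge0.
have -> : modulus x / gamma = s * (gamma1 / gamma).
  by rewrite /s mulrA divfK// gt_eqF.
have NR : 1 <= N%:R :> R by rewrite ler1n.
have sq : s * (gamma1 / gamma) <= s.
  by rewrite ler_piMr ?(ltW s0)// ler_pdivrMr// mul1r ltW.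
rewrite exprMn -/q [leRHS](_ : _ =
  k.+1%:R * N%:R ^+ d * (s ^+ N * q) * ((1 - s) ^+ k.+1)^-1); last by ring.
have sq1 : 0 < 1 - s * (gamma1 / gamma) by rewrite subr_gt0 (le_lt_trans sq).
have sNq : 0 <= s ^+ N * q by exact: mulr_ge0 (exprn_ge0 _ (ltW s0)) (ltW q0).
apply: ler_pM.
- by rewrite mulr_ge0// mulr_ge0// exprn_ge0.
- by rewrite invr_ge0 exprn_ge0// ltW.
- by rewrite ler_wpM2r// ler_wpM2l// ler_weXn2l// ltnW.
- rewrite lef_pV2 ?posrE ?exprn_gt0//.
  by apply: lerXn2r; rewrite ?nnegrE ?(ltW sq1) ?(ltW s1')// lerD2l lerN2.
Unshelve. all: by end_near. Qed.

Lemma c_hat_ge2 d (gamma1 gamma3 : R) N : 2 <= c_hat d gamma1 gamma3 N.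
Proof.
rewrite /c_hat lerDl mulr_ge0//; apply: sumr_ge0 => j _.
by rewrite !mulr_ge0 ?invr_ge0 ?exprn_ge0// mulr_ge0// addr_ge0.
Qed.

(** All powers of [N] have exponent at most [d - 1], so the value of [c_hat] at [N = 1] serves as
    constant. *)
Lemma c_hat_le d (gamma1 gamma3 : R) :
  exists2 C, 0 < C &
    forall N, (0 < N)%N -> c_hat d gamma1 gamma3 N <= C * N%:R ^+ d.-1.
Proof.
pose S := \sum_(1 <= j < d)
  (`|gamma3 / gamma1| + 1) ^+ j * (2 * d)%:R ^+ j.-1 / j`!%:R.
have S0 : 0 <= S.
  apply: sumr_ge0 => j _.
  by rewrite !mulr_ge0 ?invr_ge0 ?exprn_ge0// addr_ge0.
exists (2 + 2 * S); first by rewrite ltr_wpDr// mulr_ge0.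
move=> N N0; have NR : 1 <= N%:R :> R by rewrite ler1n.
rewrite /c_hat [leRHS]mulrDl; apply: lerD; first by rewrite ler_peMr// exprn_ege1.
rewrite -mulrA ler_wpM2l// /S big_distrl /= !big_nat.
apply: ler_sum => j /andP[j1 jd].
rewrite exprMn [leRHS]mulrC ![_ ^+ j * N%:R ^+ j]mulrC -!mulrA.
apply: ler_wpM2r; first by rewrite !mulr_ge0 ?invr_ge0 ?exprn_ge0// addr_ge0.
by rewrite ler_weXn2l// -ltnS prednK// (leq_trans _ jd).
Qed.

End ErrorBound.

(** * Minimization in the variable [t = gamma ^ N] *)

Section Minimizer.
Variable R : realType.
Implicit Types (gamma : R) (al be si t : R).

Definition reduced_bound (a b c t : R) : R := t / (b - t) + c * (a / (t - a)).

Definition reduced_min (a b c : R) : R :=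
  ((b - a) * Num.sqrt (a * b * c) - a * b * (c - 1)) / (b - a * c).

Lemma error_boundE d (gamma1 gamma2 gamma3 : R) N gamma :
    0 < gamma1 -> 0 < gamma -> 0 < gamma2 ->
    gamma1 ^+ N != gamma ^+ N -> gamma2 ^+ N != gamma ^+ N ->
  error_bound d gamma1 gamma2 gamma3 N gamma
  = reduced_bound (gamma1 ^+ N) (gamma2 ^+ N) (c_hat d gamma1 gamma3 N) (gamma ^+ N).
Proof.
move=> g1 g0 g2 n1 n2; rewrite /error_bound /reduced_bound /g !expr_div_n !div1r.
have a0 : gamma1 ^+ N != 0 by rewrite expf_neq0// gt_eqF.
have b0 : gamma2 ^+ N != 0 by rewrite expf_neq0// gt_eqF.
have t0 : gamma ^+ N != 0 by rewrite expf_neq0// gt_eqF.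
congr (_ + _ * _).
  by field; rewrite t0 subr_eq0 n2.
by field; rewrite a0 subr_eq0 eq_sym n1.
Qed.

Section SquareRoots.
(* [al], [be], [si] are the square roots of [gamma1 ^+ N], [gamma2 ^+ N] and
   [c_hat]: the minimizer and the minimum are rational in them. *)
Variables al be si : R.
Hypotheses (al0 : 0 < al) (al_be : al < be) (si0 : 0 < si) (alsi : al * si < be).

Let be0 : 0 < be. Proof. exact: lt_trans al_be. Qed.
Let den0 : 0 < be + al * si. Proof. by rewrite addr_gt0// mulr_gt0. Qed.
Let dif0 : 0 < be ^+ 2 - al ^+ 2.
Proof. by rewrite subr_gt0 ltrXn2r// ?nnegrE ltW. Qed.

(** Numerator and denominator share the factor [be - al * si], nonzero by [alsi]. *)
Lemma reduced_minE :
  reduced_min (al ^+ 2) (be ^+ 2) (si ^+ 2)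
  = al * be * (be * si + al) / (be + al * si).
Proof.
rewrite /reduced_min -!exprMn sqrtr_sqr ger0_norm; last first.
  by rewrite !mulr_ge0// ltW.
field; rewrite gt_eqF//= subr_sqr mulf_neq0 ?gt_eqF//.
by rewrite subr_gt0.
Qed.

(** With [reduced_min_subr], gives the distances to the two poles of the bound: their signs locate
    the minimizer, and their values simplify the minimum. *)
Lemma reduced_min_subl :
  reduced_min (al ^+ 2) (be ^+ 2) (si ^+ 2) - al ^+ 2
  = al * si * (be ^+ 2 - al ^+ 2) / (be + al * si).
Proof. by rewrite reduced_minE; field; rewrite gt_eqF. Qed.

Lemma reduced_min_subr :
  be ^+ 2 - reduced_min (al ^+ 2) (be ^+ 2) (si ^+ 2)
  = be * (be ^+ 2 - al ^+ 2) / (be + al * si).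
Proof. by rewrite reduced_minE; field; rewrite gt_eqF. Qed.

Lemma reduced_min_itv :
  al ^+ 2 < reduced_min (al ^+ 2) (be ^+ 2) (si ^+ 2) < be ^+ 2.
Proof.
rewrite -subr_gt0 -[_ < be ^+ 2]subr_gt0 reduced_min_subl reduced_min_subr.
by rewrite !divr_gt0 ?mulr_gt0.
Qed.

Lemma reduced_bound_min :
  reduced_bound (al ^+ 2) (be ^+ 2) (si ^+ 2)
    (reduced_min (al ^+ 2) (be ^+ 2) (si ^+ 2))
  = (2 * al * be * si + al ^+ 2 * si ^+ 2 + al ^+ 2) / (be ^+ 2 - al ^+ 2).
Proof.
rewrite /reduced_bound reduced_min_subl reduced_min_subr reduced_minE.
by field; rewrite !gt_eqF.
Qed.

(** Once denominators are cleared, the difference is quadratic in [t] with a double root at the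
    minimizer. The square yields minimality, and its vanishing yields uniqueness. *)
Lemma reduced_bound_gap t : al ^+ 2 < t -> t < be ^+ 2 ->
  reduced_bound (al ^+ 2) (be ^+ 2) (si ^+ 2) t
  - reduced_bound (al ^+ 2) (be ^+ 2) (si ^+ 2)
      (reduced_min (al ^+ 2) (be ^+ 2) (si ^+ 2))
  = ((be + al * si) * (t - reduced_min (al ^+ 2) (be ^+ 2) (si ^+ 2))) ^+ 2
    / ((be ^+ 2 - t) * (t - al ^+ 2) * (be ^+ 2 - al ^+ 2)).
Proof.
move=> t1 t2; rewrite reduced_bound_min reduced_minE /reduced_bound.
by field; rewrite !subr_eq0 !gt_eqF// -subr_gt0.
Qed.

Lemma reduced_bound_min_ge0 :
  0 <= reduced_bound (al ^+ 2) (be ^+ 2) (si ^+ 2)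
    (reduced_min (al ^+ 2) (be ^+ 2) (si ^+ 2)).
Proof.
rewrite reduced_bound_min divr_ge0 ?(ltW dif0)//.
by rewrite !addr_ge0 ?mulr_ge0 ?sqr_ge0// ltW.
Qed.

(** Both [al ^ 2 * si ^ 2] and [al ^ 2] are at most [al * be * si], whence [4 = 2 + 1 + 1]. *)
Lemma reduced_bound_min_le : 1 <= si ->
  reduced_bound (al ^+ 2) (be ^+ 2) (si ^+ 2)
    (reduced_min (al ^+ 2) (be ^+ 2) (si ^+ 2))
  <= 4 * (si * (al / be)) / (1 - (al / be) ^+ 2).
Proof.
move=> s1; rewrite reduced_bound_min.
have -> : 4 * (si * (al / be)) / (1 - (al / be) ^+ 2)
    = (4 * al * be * si) / (be ^+ 2 - al ^+ 2).
  by field; rewrite !gt_eqF.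
rewrite ler_pM2r ?invr_gt0//.
have h1 : al ^+ 2 * si ^+ 2 <= al * si * be.
  by rewrite -exprMn expr2 ler_wpM2l ?mulr_ge0// ltW.
have h2 : al * al <= al * si * be.
  by rewrite -mulrA ler_wpM2l ?(ltW al0)// (le_trans (ltW al_be))// ler_peMl// ltW.
have -> : 4 * al * be * si = 2 * al * be * si + al * si * be + al * si * be by ring.
by rewrite expr2 in h1 *; rewrite !lerD.
Qed.

End SquareRoots.
End Minimizer.

(** * The minimizer [gamma_star] for a fixed, large enough [N] *)

Section GammaStar.
Variables (R : realType) (d : nat) (gamma1 gamma2 gamma3 : R) (N : nat).
Local Open Scope classical_set_scope.
Local Notation c := (c_hat d gamma1 gamma3 N).
Local Notation gs := (gamma_star d gamma1 gamma2 gamma3 N).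
Local Notation bound := (error_bound d gamma1 gamma2 gamma3 N).
Hypotheses (N0 : (0 < N)%N) (g10 : 0 < gamma1) (g12 : gamma1 < gamma2).
Hypothesis c_small : c * gamma1 ^+ N < gamma2 ^+ N.

Let al := Num.sqrt (gamma1 ^+ N).
Let be := Num.sqrt (gamma2 ^+ N).
Let si := Num.sqrt c.

Let g20 : 0 < gamma2. Proof. exact: lt_trans g12. Qed.
Let a0 : 0 < gamma1 ^+ N. Proof. by rewrite exprn_gt0. Qed.
Let b0 : 0 < gamma2 ^+ N. Proof. by rewrite exprn_gt0. Qed.
Let c1 : 1 <= c. Proof. by rewrite (le_trans _ (c_hat_ge2 _ _ _ _))// ler1n. Qed.
Let c0 : 0 < c. Proof. exact: lt_le_trans c1. Qed.
Let al2 : al ^+ 2 = gamma1 ^+ N. Proof. by rewrite sqr_sqrtr// ltW. Qed.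
Let be2 : be ^+ 2 = gamma2 ^+ N. Proof. by rewrite sqr_sqrtr// ltW. Qed.
Let si2 : si ^+ 2 = c. Proof. by rewrite sqr_sqrtr// ltW. Qed.
Let al0 : 0 < al. Proof. by rewrite sqrtr_gt0. Qed.
Let si0 : 0 < si. Proof. by rewrite sqrtr_gt0. Qed.
Let al_be : al < be.
Proof. by rewrite ltr_sqrt// ltrXn2r ?gtn_eqF// ?nnegrE ltW. Qed.
Let alsi : al * si < be.
Proof. by rewrite -sqrtrM ?(ltW a0)// ltr_sqrt// mulrC. Qed.

Let tmin := reduced_min (gamma1 ^+ N) (gamma2 ^+ N) c.

Let tminE : tmin = reduced_min (al ^+ 2) (be ^+ 2) (si ^+ 2).
Proof. by rewrite al2 be2 si2. Qed.

Let tmin_itv : gamma1 ^+ N < tmin < gamma2 ^+ N.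
Proof. by rewrite tminE -al2 -be2 reduced_min_itv. Qed.

Let tmin0 : 0 < tmin.
Proof. by case/andP: tmin_itv => + _; exact: lt_trans. Qed.

Let gs0 : 0 < gs.
Proof.
rewrite /gamma_star !exprMn -/(reduced_min _ _ _) -/tmin.
exact: powR_gt0.
Qed.

Let gsN : gs ^+ N = tmin.
Proof.
rewrite /gamma_star !exprMn -/(reduced_min _ _ _) -/tmin.
rewrite -powR_mulrn ?powR_ge0// -powRrM div1r mulVf ?pnatr_eq0 -?lt0n//.
by rewrite powRr1// ltW.
Qed.

Let ltX (s t : R) : 0 < s -> 0 < t -> (s ^+ N < t ^+ N) = (s < t).
Proof. by move=> s0 t0; rewrite ltr_pXn2r// ?nnegrE ltW. Qed.

Lemma gamma_star_itv : gamma1 < gs < gamma2.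
Proof. by rewrite -ltX// -[gs < _]ltX// gsN. Qed.

Let boundE gamma : gamma1 < gamma -> gamma < gamma2 ->
  bound gamma = reduced_bound (al ^+ 2) (be ^+ 2) (si ^+ 2) (gamma ^+ N).
Proof.
move=> h1 h2; have h0 : 0 < gamma by exact: lt_trans h1.
rewrite al2 be2 si2 error_boundE//.
  by rewrite lt_eqF// ltX.
by rewrite gt_eqF// ltX.
Qed.

Let bound_gs :
  bound gs = reduced_bound (al ^+ 2) (be ^+ 2) (si ^+ 2)
               (reduced_min (al ^+ 2) (be ^+ 2) (si ^+ 2)).
Proof. by case/andP: gamma_star_itv => h1 h2; rewrite boundE// gsN tminE. Qed.

(** Only the sign of the denominator matters for minimality and uniqueness, so it is left
    existential. *)
Let bound_gap gamma : gamma1 < gamma -> gamma < gamma2 ->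
  exists2 D, 0 < D & bound gamma - bound gs
    = ((be + al * si) * (gamma ^+ N - gs ^+ N)) ^+ 2 / D.
Proof.
move=> h1 h2; have h0 : 0 < gamma by exact: lt_trans h1.
have t1 : al ^+ 2 < gamma ^+ N by rewrite al2 ltX.
have t2 : gamma ^+ N < be ^+ 2 by rewrite be2 ltX.
exists ((be ^+ 2 - gamma ^+ N) * (gamma ^+ N - al ^+ 2) * (be ^+ 2 - al ^+ 2)).
  by rewrite !mulr_gt0 ?subr_gt0// (lt_trans t1).
by rewrite boundE// bound_gs reduced_bound_gap// gsN tminE.
Qed.

Lemma gamma_star_minimizer :
  unique (minimizer_on [set gamma | gamma1 < gamma /\ gamma < gamma2] bound) gs.
Proof.
have /andP[s1 s2] := gamma_star_itv.
split=> [|gamma [/= [h1 h2] hmin]].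
  split=> // gamma /= [h1 h2]; have [D D0 gap] := bound_gap h1 h2.
  by rewrite -subr_ge0 gap divr_ge0 ?sqr_ge0// ltW.
have h0 : 0 < gamma by exact: lt_trans h1.
have [D D0 gap] := bound_gap h1 h2.
have := hmin gs (conj s1 s2).
rewrite -subr_le0 gap => hle.
(* A second minimizer makes the gap both nonnegative and nonpositive; the square then vanishes and
   the [N]-th powers agree. *)
have : ((be + al * si) * (gamma ^+ N - gs ^+ N)) ^+ 2 / D == 0.
  by rewrite eq_le hle divr_ge0 ?sqr_ge0// ltW.
rewrite mulf_eq0 invr_eq0 (gt_eqF D0) orbF sqrf_eq0 mulf_eq0 gt_eqF/=; last first.
  by rewrite addr_gt0 ?mulr_gt0// (lt_trans al0).
by rewrite subr_eq0 eqrXn2 ?(ltW h0) ?(ltW gs0)// => /eqP ->.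
Qed.

(** The prefactor is free of [N] because [(gamma1 / gamma2) ^ N <= gamma1 / gamma2]. The lower bound
    disposes of the absolute value in the asymptotic estimate. *)
Lemma error_bound_gamma_star :
  0 <= bound gs <= 4 / (1 - gamma1 / gamma2) * Num.sqrt (c * (gamma1 / gamma2) ^+ N).
Proof.
rewrite bound_gs reduced_bound_min_ge0//=.
have s1 : 1 <= si by rewrite -[1]sqrtr1 ler_wsqrtr.
apply: (le_trans (reduced_bound_min_le _ _ _ _ s1)) => //.
have q0 : 0 <= gamma1 / gamma2 by rewrite divr_ge0 ?ltW.
have q1 : gamma1 / gamma2 < 1 by rewrite ltr_pdivrMr// mul1r.
have -> : si * (al / be) = Num.sqrt (c * (gamma1 / gamma2) ^+ N).
  by rewrite sqrtrM ?(ltW c0)// expr_div_n sqrtrM ?(ltW a0)// sqrtrV// ltW.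
rewrite [(al / be) ^+ 2]expr_div_n al2 be2 -expr_div_n mulrAC ler_wpM2r ?sqrtr_ge0//.
rewrite ler_wpM2l// lef_pV2 ?posrE ?subr_gt0//; last first.
  by rewrite exprn_ilt1 -?lt0n.
rewrite lerD2l lerN2 -[leRHS]expr1; apply: ler_wiXn2l => //; exact: ltW.
Qed.

End GammaStar.

(** * Behaviour for large [N] *)

Section Asymptotics.
Variable R : realType.
Local Open Scope classical_set_scope.
Implicit Types gamma : R.

(** As a single square root, the rate can be compared under the root with the bound on the
    minimum. *)
Lemma decay_rateE d gamma1 gamma2 N : 0 < gamma1 -> 0 < gamma2 ->
  decay_rate d gamma1 gamma2 N = Num.sqrt (N%:R ^+ d.-1 * (gamma1 / gamma2) ^+ N).
Proof.
move=> g1 g2; rewrite /decay_rate sqrtrM ?exprn_ge0//.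
have q0 : 0 <= gamma2 / gamma1 by rewrite divr_ge0 ?ltW.
congr (_ * _).
  by rewrite -powR12_sqrt ?exprn_ge0// -powR_mulrn// -powRrM.
rewrite ger0_norm// powRN powRrM powR_mulrn// powR12_sqrt ?exprn_ge0//.
by rewrite -sqrtrV ?exprn_ge0// -exprVn invf_div.
Qed.

Lemma c_hat_near d gamma1 gamma2 gamma3 : (0 < d)%N ->
    0 < gamma1 -> gamma1 < gamma2 ->
  \forall N \near \oo, c_hat d gamma1 gamma3 N * gamma1 ^+ N < gamma2 ^+ N.
Proof.
move=> d0 g10 g12; have [C C0 hC] := c_hat_le d gamma1 gamma3.
have g20 : 0 < gamma2 by exact: lt_trans g12.
near=> N.
have N0 : (0 < N)%N by near: N; exact: nbhs_infty_gt.
(* Any constant below 1 would do; it turns a large inequality into a strict one. *)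
have h : C * N%:R ^+ d.-1 * (gamma1 / gamma2) ^+ N <= 2^-1.
  near: N; apply: natX_geometric_cvg0; rewrite ?divr_gt0//.
  by rewrite ltr_pdivrMr// mul1r.
rewrite -[ltRHS]mul1r -ltr_pdivrMr ?exprn_gt0// -mulrA -expr_div_n.
apply: (@le_lt_trans _ _ 2^-1); last by rewrite invf_lt1// ltr1n.
apply: le_trans h; rewrite ler_wpM2r ?hC//.
by rewrite exprn_ge0// divr_ge0// ltW.
Unshelve. all: by end_near. Qed.

(** Finiteness of [X] and [Y] makes the ranks of the single pairs into a common one; [2 <= c_hat]
    then gives the stated bound. *)
Lemma proxy_matrix_error_near d gamma1 gamma2 gamma3 (X Y : {fset R[i]}) : (0 < d)%N ->
    (forall x : R[i], x \in X -> 0 < modulus x /\ modulus x < gamma1) ->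
    (forall y : R[i], y \in Y -> gamma2 < modulus y /\ modulus y < gamma3) ->
  0 < gamma1 -> \forall N \near \oo, forall gamma, gamma1 < gamma -> gamma < gamma2 ->
    frobenius_norm (kernel_mx (proxy_kernel (kappa d) gamma N) X Y
                    - kernel_mx (kappa d) X Y)
    / frobenius_norm (kernel_mx (kappa d) X Y)
    <= error_bound d gamma1 gamma2 gamma3 N gamma.
Proof.
move=> d0 hX hY g10.
pose err x y N := forall gamma, gamma1 < gamma -> gamma < gamma2 ->
    modulus (proxy_kernel (kappa d) gamma N x y - kappa d x y)
    <= (g ((gamma2 / gamma) ^+ N) + 2 * g ((gamma / gamma1) ^+ N))
       * modulus (kappa d x y).
have all_err : \forall N \near \oo, (\bigcap_(x in [set` X])
    \bigcap_(y in [set` Y]) [set N | err x y N]) N.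
  apply: filter_bigI => x /hX/andP x0; apply: filter_bigI => y /hY[y0 _].
  exact: proxy_error_near.
near=> N => gamma h1 h2.
have N0 : (0 < N)%N by near: N; exact: nbhs_infty_gt.
have errN : (\bigcap_(x in [set` X]) \bigcap_(y in [set` Y]) [set N | err x y N]) N.
  by near: N; exact: all_err.
have g0 : 0 < gamma by exact: lt_trans h1.
have g20 : 0 < gamma2 by exact: lt_trans h2.
have gpos (a b : R) : 0 < a -> a < b -> 0 <= g ((b / a) ^+ N).
  move=> a0 ab; have b0 : 0 < b by exact: lt_trans ab.
  rewrite g_expV// divr_ge0 ?exprn_ge0 ?divr_ge0 ?(ltW a0) ?(ltW b0)// subr_ge0.
  exact: ltW (exp_ratio_lt1 N0 (ltW a0) ab).
have le : g ((gamma2 / gamma) ^+ N) + 2 * g ((gamma / gamma1) ^+ N)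
    <= error_bound d gamma1 gamma2 gamma3 N gamma.
  by rewrite /error_bound lerD2l ler_wpM2r ?gpos ?c_hat_ge2.
apply: frobenius_ratio.
  apply: le_trans le; apply: addr_ge0; first exact: gpos.
  by apply: mulr_ge0 => //; exact: gpos.
move=> i j; rewrite !mxE.
apply: (le_trans (errN _ _ _ _ gamma h1 h2)).
- by rewrite /= mem_nth.
- by rewrite /= mem_nth.
by rewrite ler_wpM2r ?modulus_ge0.
Unshelve. all: by end_near. Qed.

End Asymptotics.

(** * Assembly of the bound, the minimizer and the decay rate *)

Local Open Scope classical_set_scope.
Local Open Scope fset_scope.

Theorem proposition3p3 (R : realType) (d : nat) (gamma1 gamma2 gamma3 : R)
    (X Y : {fset R[i]}) :
  (2 <= d)%N ->
  gamma1 < gamma2 ->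
  X != fset0 -> Y != fset0 ->
  (forall x : R[i], x \in X -> 0 < modulus x /\ modulus x < gamma1) ->
  (forall y : R[i], y \in Y -> gamma2 < modulus y /\ modulus y < gamma3) ->
  exists N3 : nat,
    (0 < N3)%N /\
    (forall N : nat, (N3 < N)%N ->
      (forall gamma : R, gamma1 < gamma -> gamma < gamma2 ->
        frobenius_norm (kernel_mx (proxy_kernel (kappa d) gamma N) X Y
                        - kernel_mx (kappa d) X Y)
        / frobenius_norm (kernel_mx (kappa d) X Y)
        <= error_bound d gamma1 gamma2 gamma3 N gamma) /\
      unique (minimizer_on [set gamma : R | gamma1 < gamma /\ gamma < gamma2]
                (error_bound d gamma1 gamma2 gamma3 N))
             (gamma_star d gamma1 gamma2 gamma3 N)) /\
    (fun N : nat => error_bound d gamma1 gamma2 gamma3 N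
                      (gamma_star d gamma1 gamma2 gamma3 N) : R^o)
      =O_\oo (fun N : nat => decay_rate d gamma1 gamma2 N : R^o).
Proof.
move=> d2 g12 /fset0Pn[x0 xX] _ hX hY.
have d0 : (0 < d)%N by exact: leq_trans d2.
(* The modulus of a point of [X] lies strictly between 0 and [gamma1]. *)
have g10 : 0 < gamma1 by have [h1 h2] := hX _ xX; exact: lt_trans h2.
have g20 : 0 < gamma2 by exact: lt_trans g12.
have [M _ hM] := filterI (proxy_matrix_error_near d0 hX hY g10)
  (c_hat_near gamma3 d0 g10 g12).
(* The successor ensures that the rank is positive. *)
exists M.+1; split=> //; split=> [N MN|].
  have [err small] := hM N (ltnW (ltnW MN)).
  by split=> //; apply: gamma_star_minimizer => //; exact: leq_ltn_trans MN.
have [C C0 hC] := c_hat_le d gamma1 gamma3.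
have q1 : 0 < 1 - gamma1 / gamma2 by rewrite subr_gt0 ltr_pdivrMr// mul1r.
have q0 : 0 <= gamma1 / gamma2 by rewrite divr_ge0// ltW.
(* The first factor comes from [error_bound_gamma_star], and [Num.sqrt C] from
   [c_hat <= C * N ^ (d - 1)]. *)
apply/eqO_exP; exists (4 / (1 - gamma1 / gamma2) * Num.sqrt C).
  by rewrite mulr_gt0 ?divr_gt0// sqrtr_gt0.
exists M.+1 => // N /= MN.
have N0 : (0 < N)%N by exact: leq_ltn_trans MN.
have [_ small] := hM N (ltnW MN).
have /andP[b0 b1] := error_bound_gamma_star N0 g10 g12 small.
rewrite ger0_norm// decay_rateE// ger0_norm ?sqrtr_ge0//.
apply: (le_trans b1); rewrite -[leRHS]mulrA -sqrtrM ?(ltW C0)// [C * _]mulrA.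
rewrite ler_wpM2l ?divr_ge0 ?(ltW q1)// ler_wsqrtr//.
by rewrite ler_wpM2r ?exprn_ge0// hC.
Qed.
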